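(* Let $\mathcal I$ be a non-trivial admissible ideal in $\mathbb N$. Let $X$ be a real normed linear space and $S\subseteq X$ a nonempty bounded subset. Then $S$ is $M$-compact if and only if $S$ is $\mathcal I$-$M$-compact.
   Context: An ideal in $\mathbb N$ is a family $\mathcal I\subset 2^{\mathbb N}$ with $\emptyset\in\mathcal I$, closed under finite unions and under passing to subsets. It is non-trivial if $\mathbb N\notin\mathcal I$; a non-trivial ideal is admissible if $\{n\}\in\mathcal I$ for every $n\in\mathbb N$. For a non-trivial ideal $\mathcal I$, a sequence $(x_n)$ in a normed linear space (in particular in $\mathbb R$) is $\mathcal I$-convergent to $x$ if for every $\varepsilon>0$ the set $\{n:\|x_n-x\|\ge\varepsilon\}$ belongs to $\mathcal I$. For a nonempty bounded subset $G$ of a real normed linear space $X$ and $x\in X$, $\delta(x,G)=\sup\{\|x-e\|: e\in G\}$. A sequence $(x_n)$ in $G$ is maximizing in $G$ if there exists $x\in X$ such that $\|x_n-x\|\to\delta(x,G)$; it is $\mathcal I$-maximizing in $G$ if there exists $x\in X$ such that the real sequence $(\|x_n-x\|)$ is $\mathcal I$-convergent to $\delta(x,G)$. The set $G$ is $M$-compact if every maximizing sequence in $G$ has a subsequence converging (in norm) to an element of $G$; it is $\mathcal I$-$M$-compact if every $\mathcal I$-maximizing sequence in $G$ has a subsequence converging (in norm) to an element of $G$. *)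

(* Defs.v *)
From mathcomp Require Import all_boot all_order all_algebra.
From mathcomp Require Import all_classical all_reals all_analysis.

Set Implicit Arguments.
Unset Strict Implicit.
Unset Printing Implicit Defensive.

Import Order.TTheory GRing.Theory Num.Theory.
Import numFieldNormedType.Exports.

Local Open Scope classical_set_scope.
Local Open Scope ring_scope.

Definition is_ideal (I : set (set nat)) : Prop :=
  [/\ I set0,
      forall A B : set nat, I A -> I B -> I (A `|` B)
    & forall A B : set nat, A `<=` B -> I B -> I A].

Definition nontrivial_ideal (I : set (set nat)) : Prop :=
  is_ideal I /\ ~ I setT.

Definition admissible_ideal (I : set (set nat)) : Prop :=
  nontrivial_ideal I /\ forall n : nat, I [set n].

Definition ideal_cvg (I : set (set nat)) (R : realType) (V : normedModType R)
    (x : nat -> V) (l : V) : Prop :=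
  forall e : R, 0 < e -> I [set n | e <= `|x n - l|].

Section MCompactness.
Variables (R : realType) (X : normedModType R).
Implicit Types (G : set X) (x : nat -> X).

(* The supremum is the intended one when [G] is nonempty and bounded;
   otherwise [sup] returns the junk value 0. *)
Definition farthest_dist (p : X) G : R := sup [set `|p - e| | e in G].

Definition maximizing G x : Prop :=
  (forall n, G (x n)) /\
  exists p : X, `|x n - p| @[n --> \oo] --> farthest_dist p G.

Definition ideal_maximizing (I : set (set nat)) G x : Prop :=
  (forall n, G (x n)) /\
  exists p : X,
    ideal_cvg I (fun n => `|x n - p| : R^o) (farthest_dist p G).

Definition has_subseq_cvg_in G x : Prop :=
  exists k : nat -> nat,
    increasing_seq k /\ exists2 l : X, G l & x (k n) @[n --> \oo] --> l.

Definition M_compact G : Prop :=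
  forall x : nat -> X, maximizing G x -> has_subseq_cvg_in G x.

Definition ideal_M_compact (I : set (set nat)) G : Prop :=
  forall x : nat -> X, ideal_maximizing I G x -> has_subseq_cvg_in G x.

End MCompactness.

(* Main.v *)
Require Import Defs.
From mathcomp Require Import all_boot all_order all_algebra.
From mathcomp Require Import all_classical all_reals all_analysis.

(** Admissibility says that the ideal contains every finite set, and
    non-triviality then says that it contains no cofinite set.

    The first fact makes every convergent sequence ideal-convergent to the same
    limit ([cvg_ideal_cvg]), so maximizing sequences are ideal-maximizing, and
    the ideal version of M-compactness is the stronger one.

    The second fact makes the complement of a member of the ideal infinite
    ([ideal_compl_unbounded]).  An ideal-convergent sequence is therefore within
    any given distance of its limit at arbitrarily large indices, and a greedy
    choice of indices yields a subsequence with an ordinary limit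
    ([ideal_cvg_subseq]).  Applied to the distances [`|x n - p|], this extracts
    from an ideal-maximizing sequence a maximizing subsequence with the same
    centre [p]; M-compactness gives a convergent sub-subsequence, which is a
    subsequence of the original sequence ([has_subseq_cvg_in_comp]). *)

Set Implicit Arguments.
Unset Strict Implicit.
Unset Printing Implicit Defensive.

Import Order.TTheory GRing.Theory Num.Theory.
Import numFieldNormedType.Exports.

Local Open Scope classical_set_scope.
Local Open Scope ring_scope.

Lemma admissible_ideal_initial (I : set (set nat)) (n : nat) :
  admissible_ideal I -> I `I_n.
Proof.
move=> [[[I0 IU _] _] I1]; elim: n => [|n IHn]; first by rewrite II0.
by rewrite IIS; apply: IU.
Qed.

Lemma ideal_compl_unbounded (I : set (set nat)) (A : set nat) (m : nat) :
  admissible_ideal I -> I A -> exists2 n, (m < n)%N & ~ A n.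
Proof.
move=> hI IA; apply: contrapT => noN.
have [[[_ IU IS] IT] _] := hI; apply: IT.
apply: (IS _ (A `|` `I_m.+1)); last first.
  by apply: IU => //; exact: admissible_ideal_initial.
move=> n _; have [lt_nm|lt_mn] := ltnP n m.+1; first by right.
by left; apply: contrapT => nAn; apply: noN; exists n.
Qed.

Section IdealConvergence.
Context {R : realType} {V : normedModType R}.
Implicit Types (I : set (set nat)) (x : nat -> V) (l : V).

(** The exceptional indices of a convergent sequence lie in an initial
    segment, which belongs to every admissible ideal. *)
Lemma cvg_ideal_cvg I x l :
  admissible_ideal I -> x n @[n --> \oo] --> l -> ideal_cvg I x l.
Proof.
move=> hI /cvgrPdist_lt xl e e0; have [[[_ _ IS] _] _] := hI.
have [N _ xN] := xl _ e0.
apply: (IS _ `I_N); last exact: admissible_ideal_initial.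
move=> n /= e_le; rewrite ltnNge; apply/negP => leNn.
by have := xN n leNn; rewrite /= distrC ltNge e_le.
Qed.

(** The [n]-th index is chosen beyond the previous one and at a place where
    the sequence is within [1 / n.+1] of its limit; such a place exists because
    the set of bad indices is in the ideal. *)
Lemma ideal_cvg_subseq I x l :
  admissible_ideal I -> ideal_cvg I x l ->
  exists2 k : nat -> nat, increasing_seq k & x (k n) @[n --> \oo] --> l.
Proof.
move=> hI xl.
have next (jm : nat * nat) :
    exists n, (jm.2 < n)%N /\ `|x n - l| < jm.1.+1%:R^-1 :> R.
  have e0 : 0 < jm.1.+1%:R^-1 :> R by rewrite invr_gt0.
  have [n ltmn /= /negP ngood] := ideal_compl_unbounded jm.2 hI (xl _ e0).
  by exists n; rewrite ltNge.
have [f fP] := choice next.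
pose k := fix k n := if n is j.+1 then f (n, k j) else f (0%N, 0%N).
exists k; first by apply/increasing_seqP => n; have [] := fP (n.+1, k n).
have near_l n : `|x (k n) - l| < n.+1%:R^-1 :> R.
  case: n => [|n]; first by have [] := fP (0%N, 0%N).
  by have [] := fP (n.+1, k n).
apply/cvgrPdist_lt => e e0; near=> n; rewrite distrC.
apply: (lt_trans (near_l n)); near: n.
exact: (near_infty_natSinv_lt (PosNum e0)).
Unshelve. all: by end_near.
Qed.

End IdealConvergence.

Lemma has_subseq_cvg_in_comp (R : realType) (X : normedModType R) (G : set X)
    (x : nat -> X) (k : nat -> nat) :
  increasing_seq k -> has_subseq_cvg_in G (fun n => x (k n)) ->
  has_subseq_cvg_in G x.
Proof.
move=> inck [j [incj [l Gl xl]]]; exists (k \o j); split; last by exists l.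
by move=> m n /=; rewrite inck; exact: incj.
Qed.

Theorem proposition4p14 (R : realType) (I : set (set nat))
    (hI : admissible_ideal I) (X : normedModType R) (S : set X)
    (S_nonempty : (S !=set0)%classic) (S_bounded : bounded_set S) :
  M_compact S <-> ideal_M_compact I S.
Proof.
split=> cptS x [Sx [p xp]].
  have [k inck kp] := ideal_cvg_subseq hI xp.
  apply: (has_subseq_cvg_in_comp inck); apply: cptS.
  by split=> [n|]; [exact: Sx | exists p].
by apply: cptS; split=> //; exists p; exact: cvg_ideal_cvg.
Qed.
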